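(* Consider a semi-explicit index-1 DAE (SE-DAE) with matrices $(E,A,B,C,D)$ and its underlying ODE $(E_1,A_1,B_1,C_1,D_1)$ as defined in the context. Let $S_V\in\mathbb{R}^{n\times n}$, $R\in\mathbb{R}^{m\times n}$, and let $V=\begin{bmatrix} V_1 \\ V_2 \end{bmatrix}\in\mathbb{R}^{N\times n}$ (with $V_1\in\mathbb{R}^{n_{dyn}\times n}$) be a matrix of full column rank satisfying $$A V - E V S_V - B R = 0,$$ so that $V_1$ satisfies $A_1V_1-E_1V_1S_V-B_1R=0$. Assume $B_{22}=0$. Then the reduced order model obtained by orthogonal projection ($W=V$) of the SE-DAE is equivalent to the one obtained by orthogonal projection ($W_1=V_1$) of the underlying ODE; that is, with $D_{imp}:=-C_{22}A_{22}^{-1}B_{22}$, $$V^\top E V = V_1^\top E_1 V_1,\quad V^\top A V = V_1^\top A_1 V_1,\quad V^\top B = V_1^\top B_1,\quad C V + D_{imp}R = C_1V_1,\quad D + D_{imp} = D_1 .$$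
   Context: An SE-DAE is a system $E\dot x = Ax+Bu$, $y=Cx+Du$ with real matrices, $x(t)\in\mathbb{R}^N$, $u(t)\in\mathbb{R}^m$, $y(t)\in\mathbb{R}^p$, partitioned as $$E=\begin{bmatrix} E_{11} & 0 \\ 0 & 0 \end{bmatrix},\quad A=\begin{bmatrix} A_{11} & A_{12} \\ A_{21} & A_{22} \end{bmatrix},\quad B=\begin{bmatrix} B_{11} \\ B_{22} \end{bmatrix},\quad C=[C_{11},\,C_{22}],$$ where $E_{11}\in\mathbb{R}^{n_{dyn}\times n_{dyn}}$, $\det E_{11}\neq0$, $\det A_{22}\neq 0$ and all blocks are partitioned conformally. Its underlying ODE is $E_1\dot x_1=A_1x_1+B_1u$, $y=C_1x_1+D_1u$ with $$E_1=E_{11},\quad A_1=A_{11}-A_{12}A_{22}^{-1}A_{21},\quad B_1=B_{11}-A_{12}A_{22}^{-1}B_{22},\quad C_1=C_{11}-C_{22}A_{22}^{-1}A_{21},\quad D_1=D-C_{22}A_{22}^{-1}B_{22}.$$ The reduced model (reduced order model) of the SE-DAE obtained by projection with matrices $V,W\in\mathbb{R}^{N\times n}$ and tangential direction matrices $R\in\mathbb{R}^{m\times n}$, $L\in\mathbb{R}^{n\times p}$ has matrices $E_r=W^\top EV$, $A_r=W^\top AV+L D_{imp}R$, $B_r=W^\top B+L D_{imp}$, $C_r=CV+D_{imp}R$, $D_r=D+D_{imp}$; for orthogonal projection based on an input Krylov subspace (only $V$ computed), $L=0$ and $W=V$. The reduced model of the underlying ODE obtained with $V_1$ by orthogonal projection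 is $(V_1^\top E_1V_1, V_1^\top A_1V_1,V_1^\top B_1,C_1V_1,D_1)$. *)

(* Defs.v *)
From HB Require Import structures.
From mathcomp Require Import all_boot all_order all_algebra.
From mathcomp Require Import reals.

Set Implicit Arguments.
Unset Strict Implicit.
Unset Printing Implicit Defensive.

Import GRing.Theory Num.Theory.
Local Open Scope ring_scope.

(* Matrices of the system E x' = A x + B u, y = C x + D u, with N states,
   m inputs and p outputs. *)
Record system (K : realType) (N m p : nat) := System {
  sysE : 'M[K]_N;
  sysA : 'M[K]_N;
  sysB : 'M[K]_(N, m);
  sysC : 'M[K]_(p, N);
  sysD : 'M[K]_(p, m) }.

(* Semi-explicit index-1 DAE, given by its blocks; the state dimension is
   N = ndyn + nalg. *)
Record sedae (K : realType) (ndyn nalg m p : nat) := SEDAE {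
  E11 : 'M[K]_ndyn;
  A11 : 'M[K]_ndyn;
  A12 : 'M[K]_(ndyn, nalg);
  A21 : 'M[K]_(nalg, ndyn);
  A22 : 'M[K]_nalg;
  B11 : 'M[K]_(ndyn, m);
  B22 : 'M[K]_(nalg, m);
  C11 : 'M[K]_(p, ndyn);
  C22 : 'M[K]_(p, nalg);
  Dft : 'M[K]_(p, m);
  det_E11_neq0 : \det E11 != 0;
  det_A22_neq0 : \det A22 != 0 }.

Definition dae_system (K : realType) (ndyn nalg m p : nat)
    (S : sedae K ndyn nalg m p) : system K (ndyn + nalg) m p :=
  {| sysE := block_mx (E11 S) 0 0 0;
     sysA := block_mx (A11 S) (A12 S) (A21 S) (A22 S);
     sysB := col_mx (B11 S) (B22 S);
     sysC := row_mx (C11 S) (C22 S);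
     sysD := Dft S |}.

Definition underlying_ode (K : realType) (ndyn nalg m p : nat)
    (S : sedae K ndyn nalg m p) : system K ndyn m p :=
  {| sysE := E11 S;
     sysA := A11 S - A12 S *m invmx (A22 S) *m A21 S;
     sysB := B11 S - A12 S *m invmx (A22 S) *m B22 S;
     sysC := C11 S - C22 S *m invmx (A22 S) *m A21 S;
     sysD := Dft S - C22 S *m invmx (A22 S) *m B22 S |}.

Definition Dimp (K : realType) (ndyn nalg m p : nat)
    (S : sedae K ndyn nalg m p) : 'M[K]_(p, m) :=
  - (C22 S *m invmx (A22 S) *m B22 S).

Definition sedae_rom (K : realType) (ndyn nalg m p n : nat)
    (S : sedae K ndyn nalg m p) (V W : 'M[K]_(ndyn + nalg, n))
    (R : 'M[K]_(m, n)) (L : 'M[K]_(n, p)) : system K n m p :=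
  {| sysE := W^T *m sysE (dae_system S) *m V;
     sysA := W^T *m sysA (dae_system S) *m V + L *m Dimp S *m R;
     sysB := W^T *m sysB (dae_system S) + L *m Dimp S;
     sysC := sysC (dae_system S) *m V + Dimp S *m R;
     sysD := sysD (dae_system S) + Dimp S |}.

(* Orthogonal projection on an input Krylov subspace: only V is computed, so
   W = V and the left tangential directions L vanish. *)
Definition sedae_orth_rom (K : realType) (ndyn nalg m p n : nat)
    (S : sedae K ndyn nalg m p) (V : 'M[K]_(ndyn + nalg, n))
    (R : 'M[K]_(m, n)) : system K n m p :=
  sedae_rom S V V R 0.

Definition ode_orth_rom (K : realType) (N m p n : nat)
    (T : system K N m p) (V : 'M[K]_(N, n)) : system K n m p :=
  {| sysE := V^T *m sysE T *m V;
     sysA := V^T *m sysA T *m V;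
     sysB := V^T *m sysB T;
     sysC := sysC T *m V;
     sysD := sysD T |}.

Definition input_sylvester (K : realType) (N m p n : nat)
    (T : system K N m p) (V : 'M[K]_(N, n)) (SV : 'M[K]_n)
    (R : 'M[K]_(m, n)) : Prop :=
  sysA T *m V - sysE T *m V *m SV - sysB T *m R = 0.

(* Main.v *)
Require Import Defs.
From HB Require Import structures.
From mathcomp Require Import all_boot all_order all_algebra.
From mathcomp Require Import reals.

Set Implicit Arguments.
Unset Strict Implicit.
Unset Printing Implicit Defensive.

Import GRing.Theory Num.Theory.
Local Open Scope ring_scope.

(* The algebraic rows of the Sylvester equation force
   V2 = A22^-1 (B22 R - A21 V1); substituting this into the dynamic rows gives
   the Sylvester equation of the underlying ODE.  When B22 = 0, the algebraic
   rows of A V and of B vanish, so V2^T contributes nothing to V^T A V and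
   V^T B. *)

Lemma sylvester_blocks (K : realType) (ndyn nalg m p n : nat)
    (S : sedae K ndyn nalg m p) (SV : 'M[K]_n) (R : 'M[K]_(m, n))
    (V1 : 'M[K]_(ndyn, n)) (V2 : 'M[K]_(nalg, n)) :
  input_sylvester (dae_system S) (col_mx V1 V2) SV R ->
  A11 S *m V1 + A12 S *m V2 = E11 S *m V1 *m SV + B11 S *m R /\
  A21 S *m V1 + A22 S *m V2 = B22 S *m R.
Proof.
rewrite /input_sylvester /= !mul_block_col !mul0mx !addr0 !mul_col_mx !mul0mx.
rewrite !opp_col_mx !add_col_mx -(col_mx0 K) => /eq_col_mx[].
rewrite oppr0 addr0 -addrA -opprD => /eqP + /eqP.
by rewrite !subr_eq0 => /eqP-> /eqP->.
Qed.

(** This is where index 1 enters: [A22 S] is a unit because its determinant is nonzero, so the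
    algebraic rows determine [V2] from [V1] and [R]. *)
Lemma algebraic_state (K : realType) (ndyn nalg m p n : nat)
    (S : sedae K ndyn nalg m p) (R : 'M[K]_(m, n))
    (V1 : 'M[K]_(ndyn, n)) (V2 : 'M[K]_(nalg, n)) :
  A21 S *m V1 + A22 S *m V2 = B22 S *m R ->
  V2 = invmx (A22 S) *m (B22 S *m R - A21 S *m V1).
Proof.
move=> <-; rewrite addrAC subrr add0r mulKmx //.
by rewrite unitmxE unitfE det_A22_neq0.
Qed.

Theorem theorem3p1 (K : realType) (ndyn nalg m p n : nat)
    (S : sedae K ndyn nalg m p) (SV : 'M[K]_n) (R : 'M[K]_(m, n))
    (V1 : 'M[K]_(ndyn, n)) (V2 : 'M[K]_(nalg, n))
    (V : 'M[K]_(ndyn + nalg, n)) (V_def : V = col_mx V1 V2)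
    (V_full_col_rank : \rank V = n)
    (V_sylvester : input_sylvester (dae_system S) V SV R) :
  input_sylvester (underlying_ode S) V1 SV R /\
  (B22 S = 0 ->
   sedae_orth_rom S V R = ode_orth_rom (underlying_ode S) V1 /\
   [/\ V^T *m sysE (dae_system S) *m V
         = V1^T *m sysE (underlying_ode S) *m V1,
       V^T *m sysA (dae_system S) *m V
         = V1^T *m sysA (underlying_ode S) *m V1,
       V^T *m sysB (dae_system S) = V1^T *m sysB (underlying_ode S),
       sysC (dae_system S) *m V + Dimp S *m R
         = sysC (underlying_ode S) *m V1 &
       sysD (dae_system S) + Dimp S = sysD (underlying_ode S)]).
Proof.
rewrite {}V_def {V V_full_col_rank} in V_sylvester *.
have [dynE algE] := sylvester_blocks V_sylvester.
have V2E := algebraic_state algE.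
split=> [|B220].
  move: dynE; rewrite V2E /input_sylvester /= !mulmxBl !mulmxBr !mulmxA.
  (* The zero on the right becomes the residual of the dynamic rows; both sides then have the same
     five terms, and the permutation moves A12 A22^-1 B22 R into second place. *)
  move/eqP; rewrite -subr_eq0 => /eqP <-; rewrite opprB opprD !addrA.
  by rewrite [LHS](ACl (1*4*2*3*5)).
have DimpE : Dimp S = 0 by rewrite /Dimp B220 mulmx0 oppr0.
rewrite B220 mul0mx sub0r mulmxN in V2E.
rewrite B220 mul0mx in algE.
have eE : (col_mx V1 V2)^T *m sysE (dae_system S) *m col_mx V1 V2
    = V1^T *m sysE (underlying_ode S) *m V1.
  by rewrite -mulmxA mul_block_col tr_col_mx mul_row_col !mul0mx !addr0 mulmx0
    addr0 mulmxA.
have aE : (col_mx V1 V2)^T *m sysA (dae_system S) *m col_mx V1 V2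
    = V1^T *m sysA (underlying_ode S) *m V1.
  (* Forming A V first exposes its lower block, which [algE] makes zero, so [V2^T] drops out; in the
     upper block, V2 = - A22^-1 A21 V1 yields the Schur complement of [A22 S]. *)
  rewrite -mulmxA mul_block_col algE tr_col_mx mul_row_col mulmx0 addr0.
  by rewrite -[RHS]mulmxA mulmxBl V2E mulmxN !mulmxA.
have bE : (col_mx V1 V2)^T *m sysB (dae_system S)
    = V1^T *m sysB (underlying_ode S).
  by rewrite tr_col_mx mul_row_col /= B220 !mulmx0 addr0 subr0.
have cE : sysC (dae_system S) *m col_mx V1 V2 + Dimp S *m R
    = sysC (underlying_ode S) *m V1.
  by rewrite DimpE mul0mx addr0 mul_row_col mulmxBl V2E mulmxN !mulmxA.
split=> //.
(* The systems agree field by field: [L] is zero, which removes the remaining [Dimp S] terms from A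
   and B, and the feedthrough fields agree by conversion. *)
by rewrite /sedae_orth_rom /sedae_rom /ode_orth_rom eE aE bE cE !mul0mx !addr0.
Qed.
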